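(* Let $\gamma_j\colon[0,+\infty)\to\mathbb{H}$, $j=1,2$, be two curves landing at $\infty$, with $$\lim_{t\to+\infty}\arg(\gamma_j(t))=\theta,\qquad j=1,2,$$ for some $\theta\in(-\tfrac{\pi}{2},\tfrac{\pi}{2})$. Let $\{z_n\}\subset\mathbb{H}$ be a sequence converging to $\infty$. If $\pi_{\gamma_j}(z_n)$ is a projection of $z_n$ onto $\gamma_j$, for $j=1,2$ and $n\in\mathbb{N}$, then $$\lim_{n\to+\infty}d_{\mathbb{H}}(\pi_{\gamma_1}(z_n),\pi_{\gamma_2}(z_n))=0.$$
   Context: $\mathbb{H}=\{w\in\mathbb{C}:\mathrm{Re}\,w>0\}$ is the right half-plane, with hyperbolic metric $$d_{\mathbb{H}}(z,w)=\frac12\log\frac{1+\left|\frac{z-w}{z+\overline{w}}\right|}{1-\left|\frac{z-w}{z+\overline{w}}\right|},\qquad z,w\in\mathbb{H}.$$ A curve is a continuous map $\gamma\colon[0,+\infty)\to\mathbb{H}$; it lands at $\infty$ if $\gamma(t)\to\infty$ (i.e. $|\gamma(t)|\to+\infty$) as $t\to+\infty$. A sequence in $\mathbb{H}$ converges to $\infty$ if its modulus tends to $+\infty$. Given $z_0\in\mathbb{H}$, a point $\pi_\gamma(z_0)$ is a projection of $z_0$ onto $\gamma$ if $\pi_\gamma(z_0)=\gamma(t_0)$ for some $t_0\ge0$ and $d_{\mathbb{H}}(z_0,\gamma(t_0))=\inf\{d_{\mathbb{H}}(z_0,\gamma(t)):t\in[0,+\infty)\}$ (projections exist but need not be unique).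 $\arg$ is the principal argument, with values in $(-\tfrac{\pi}{2},\tfrac{\pi}{2})$ on $\mathbb{H}$. *)

(* Defs.v *)
(* Stdlib reals with Coquelicot. *)
From Stdlib Require Import Reals Lra Psatz.
From Coquelicot Require Import Coquelicot.
Open Scope R_scope.

Definition right_half_plane (z : C) : Prop := 0 < Re z.

Definition dH (z w : C) : R :=
  / 2 * ln ((1 + Cmod ((z - w) / (z + Cconj w))) /
            (1 - Cmod ((z - w) / (z + Cconj w)))).

(* Principal argument with values in (-PI, PI]; see Arg_polar and Arg_bound.
   The value Arg 0 is a junk value. *)
Definition Arg (z : C) : R :=
  if Rle_dec 0 (Im z) then acos (Re z / Cmod z) else - acos (Re z / Cmod z).

(* A curve [0, +oo) -> H is represented by a function on R of which only the
   restriction to [0, +oo) matters; in particular continuity at 0 is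
   one-sided. *)
Definition curve (gamma : R -> C) : Prop :=
  continuous_on (fun t : R => 0 <= t) gamma /\
  (forall t : R, 0 <= t -> right_half_plane (gamma t)).

Definition lands_at_infty (gamma : R -> C) : Prop :=
  is_lim (fun t : R => Cmod (gamma t)) p_infty p_infty.

Definition converges_to_infty (z : nat -> C) : Prop :=
  is_lim_seq (fun n : nat => Cmod (z n)) p_infty.

Definition is_projection (gamma : R -> C) (z0 p : C) : Prop :=
  exists t0 : R, 0 <= t0 /\ p = gamma t0 /\
    is_glb_Rbar (fun d : R => exists t : R, 0 <= t /\ d = dH z0 (gamma t))
                (dH z0 (gamma t0)).

Lemma Re_div_Cmod_bound (z : C) : z <> 0%C -> -1 <= Re z / Cmod z <= 1.
Proof.
intros Hz.
assert (Hm : 0 < Cmod z) by now apply Cmod_gt_0.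
assert (Hr : Rabs (Re z) <= Cmod z).
{ apply Rle_trans with (2 := Rmax_Cmod z). apply Rmax_l. }
apply Rabs_le_between.
unfold Rdiv; rewrite Rabs_mult, (Rabs_pos_eq (/ Cmod z)).
- apply Rmult_le_reg_r with (Cmod z); [lra|]. field_simplify; lra.
- apply Rlt_le, Rinv_0_lt_compat, Hm.
Qed.

Lemma Arg_bound (z : C) : z <> 0%C -> - PI < Arg z <= PI.
Proof.
intros Hz; unfold Arg.
pose proof (acos_bound (Re z / Cmod z)) as Hb; pose proof PI_RGT_0 as Hpi.
destruct (Rle_dec 0 (Im z)) as [Hi|Hi]; [lra|].
split; [|lra].
destruct (Req_dec (acos (Re z / Cmod z)) PI) as [He|He]; [exfalso|lra].
assert (Hc : Re z / Cmod z = -1).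
{ rewrite <- (cos_acos _ (Re_div_Cmod_bound z Hz)), He; apply cos_PI. }
assert (Hm : 0 < Cmod z) by now apply Cmod_gt_0.
assert (Hr : Re z = - Cmod z).
{ apply Rmult_eq_reg_r with (/ Cmod z).
  - unfold Rdiv in Hc; rewrite Hc; field; lra.
  - apply Rinv_neq_0_compat; lra. }
assert (Hs : Cmod z ^ 2 = Re z ^ 2 + Im z ^ 2).
{ unfold Cmod; rewrite pow2_sqrt; [reflexivity|nra]. }
nra.
Qed.

Lemma Arg_polar (z : C) : z <> 0%C ->
  z = (Cmod z * cos (Arg z), Cmod z * sin (Arg z)).
Proof.
intros Hz.
assert (Hm : 0 < Cmod z) by now apply Cmod_gt_0.
pose proof (Re_div_Cmod_bound z Hz) as Hb.
assert (Hs : Cmod z ^ 2 = Re z ^ 2 + Im z ^ 2).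
{ unfold Cmod; rewrite pow2_sqrt; [reflexivity|nra]. }
assert (Hq : sqrt (1 - (Re z / Cmod z)²) = Rabs (Im z) / Cmod z).
{ replace (1 - (Re z / Cmod z)²) with ((Im z / Cmod z)²).
  - rewrite sqrt_Rsqr_abs, Rabs_div, (Rabs_pos_eq (Cmod z)); lra.
  - unfold Rsqr; apply Rmult_eq_reg_r with (Cmod z ^ 2); [|nra].
    field_simplify; nra. }
apply injective_projections; simpl; fold (Re z); fold (Im z); unfold Arg;
  destruct (Rle_dec 0 (Im z)) as [Hi|Hi];
  rewrite ?cos_neg, ?sin_neg, ?cos_acos, ?sin_acos, ?Hq by exact Hb.
- field; lra.
- field; lra.
- rewrite Rabs_pos_eq by exact Hi; field; lra.
- rewrite Rabs_left by lra; field; lra.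
Qed.

(* Main.v *)
Require Import Defs.
From Stdlib Require Import Reals Lra Psatz IndefiniteDescription.
From Coquelicot Require Import Coquelicot.
Open Scope R_scope.

(** Put [S(z,w) = |z-w|^2 / (Re z Re w)], written [sep] below. Then
    [dH z w = arcsinh (sqrt (S(z,w)) / 2)] ([dH_arcsinh]), so a nearest point
    for [dH] is a nearest point for [S], and [dH] tends to [0] as soon as [S]
    does. Unlike [dH], [S] is an elementary expression in polar coordinates,
    and it is invariant under dilations.

    The idea is that far away the curve [gamma] looks like the ray of argument
    [theta], and that the projection of [z] onto that ray is the point of the
    ray with modulus [|z|], whatever the argument of [z] is. To make this
    quantitative, take a point [w] on [gamma] with [|w| = |z|]; it exists for
    large [z] by the intermediate value theorem ([curve_meets_circle]). Let
    [p] be a projection of [z], with [x' + i y' = p/|p|], [x + i y = w/|w|] and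
    [q = |p|/|z|]. The inequality [S(z,p) <= S(z,w)] implies
    [q + 1/q - 2 <= 2 |x'/x - 1| + 2 |y' - y x'/x|], a bound from which the
    argument of [z] has disappeared ([Cmod_ratio_of_sep_le]); this matters
    because nothing prevents that argument from approaching [PI/2].

    This inequality is used twice along the sequence ([projection_asymptotics]).
    Since [x'], [y'] and [y] lie between [-1] and [1] and [x] tends to [cos theta > 0], the
    right-hand side is bounded; so [|z|/|p|] is bounded and [p] tends to
    infinity. Hence the direction of [p], like that of [w], tends to
    [e^(i theta)] ([direction_limit]). Now the right-hand side tends to [0], so
    [q] tends to [1]. In conclusion [p/|z|] tends to [e^(i theta)] for both
    curves, and dilation invariance of [S] makes [S] between the two
    projections tend to [0]. *)

(** * The hyperbolic distance as a function of an algebraic separation *)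

Definition sep (z w : C) : R :=
  ((Re z - Re w) ^ 2 + (Im z - Im w) ^ 2) / (Re z * Re w).

Lemma Cmod_sqr (z : C) : Cmod z ^ 2 = Re z ^ 2 + Im z ^ 2.
Proof. unfold Cmod; rewrite pow2_sqrt; [reflexivity | nra]. Qed.

Lemma Cmod_pos_half_plane (z : C) : right_half_plane z -> 0 < Cmod z.
Proof.
unfold right_half_plane; intros Hz; apply Cmod_gt_0; intros ->; simpl in Hz; lra.
Qed.

Lemma sep_nonneg (z w : C) :
  right_half_plane z -> right_half_plane w -> 0 <= sep z w.
Proof.
unfold right_half_plane; intros Hz Hw; unfold sep.
apply Rdiv_le_0_compat; [| now apply Rmult_lt_0_compat].
apply Rplus_le_le_0_compat; apply pow2_ge_0.
Qed.

(** With [A = |z-w|], [B = |z + conj w|] and [m = sqrt (Re z Re w)], the identity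
    [B^2 = A^2 + 4 m^2] gives [(B+A)/(B-A) = ((A+B)/(2m))^2]. The left-hand side
    is the argument of the logarithm in [dH], and
    [(A+B)/(2m) = u + sqrt (u^2 + 1)] for [u = A/(2m)]. *)
Lemma dH_arcsinh (z w : C) :
  right_half_plane z -> right_half_plane w ->
  dH z w = arcsinh (sqrt (sep z w) / 2).
Proof.
intros Hz Hw; unfold right_half_plane in *.
assert (Hzw : 0 < Re z * Re w) by nra.
assert (Hnz : (z + Cconj w)%C <> 0%C).
{ intros H; apply (f_equal Re) in H; destruct z, w; simpl in *; lra. }
unfold dH; rewrite Cmod_div by exact Hnz.
set (A := Cmod (z - w)%C); set (B := Cmod (z + Cconj w)%C).
assert (HA0 : 0 <= A) by apply Cmod_ge_0.
assert (HB0 : 0 < B) by now apply Cmod_gt_0.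
assert (HA : A ^ 2 = (Re z - Re w) ^ 2 + (Im z - Im w) ^ 2).
{ unfold A; rewrite Cmod_sqr; destruct z, w; simpl; ring. }
assert (HB : B ^ 2 = A ^ 2 + 4 * (Re z * Re w)).
{ rewrite HA; unfold B; rewrite Cmod_sqr; destruct z, w; simpl; ring. }
set (m := sqrt (Re z * Re w)).
assert (Hm : 0 < m) by now apply sqrt_lt_R0.
assert (Hm2 : m ^ 2 = Re z * Re w) by (apply pow2_sqrt; lra).
assert (Hs : sqrt (sep z w) = A / m).
{ unfold sep; rewrite <- HA, <- Hm2, sqrt_div_alt by nra.
  now rewrite !sqrt_pow2 by lra. }
assert (HAB : A < B) by nra.
assert (Hr : sqrt ((A / m / 2) ^ 2 + 1) = B / (2 * m)).
{ replace ((A / m / 2) ^ 2 + 1) with ((B / (2 * m)) ^ 2).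
  - apply sqrt_pow2, Rlt_le, Rdiv_lt_0_compat; lra.
  - rewrite <- Hm2 in HB.
    replace ((B / (2 * m)) ^ 2) with (B ^ 2 / (2 * m) ^ 2) by (field; lra).
    rewrite HB; field; lra. }
rewrite Hs; unfold arcsinh; rewrite Hr.
assert (Hq : 0 < A / m / 2 + B / (2 * m)).
{ replace (A / m / 2 + B / (2 * m)) with ((A + B) / (2 * m)) by (field; lra).
  apply Rdiv_lt_0_compat; lra. }
replace ((1 + A / B) / (1 - A / B))
  with ((A / m / 2 + B / (2 * m)) * (A / m / 2 + B / (2 * m))).
- rewrite ln_mult by exact Hq; lra.
- replace ((1 + A / B) / (1 - A / B)) with ((A + B) ^ 2 / (B ^ 2 - A ^ 2)).
  + rewrite HB, <- Hm2; field; lra.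
  + field; repeat split; try lra; nra.
Qed.

Lemma sep_le_of_dH_le (z w w' : C) :
  right_half_plane z -> right_half_plane w -> right_half_plane w' ->
  dH z w <= dH z w' -> sep z w <= sep z w'.
Proof.
intros Hz Hw Hw' Hd.
rewrite !dH_arcsinh in Hd by assumption.
destruct (Rle_lt_dec (sep z w) (sep z w')) as [H | H]; [exact H | exfalso].
apply sqrt_lt_1 in H; [| now apply sep_nonneg | now apply sep_nonneg].
apply (Rle_not_lt _ _ Hd), arcsinh_lt; lra.
Qed.

Lemma is_lim_seq_dH_0 (z w : nat -> C) :
  (forall n, right_half_plane (z n)) -> (forall n, right_half_plane (w n)) ->
  is_lim_seq (fun n => sep (z n) (w n)) 0 ->
  is_lim_seq (fun n => dH (z n) (w n)) 0.
Proof.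
intros Hz Hw Hs.
apply is_lim_seq_ext with (fun n => arcsinh (sqrt (sep (z n) (w n)) * / 2)).
{ intros n; now rewrite dH_arcsinh. }
assert (H0 : 0 = arcsinh (sqrt 0 * / 2)).
{ now rewrite sqrt_0, Rmult_0_l, arcsinh_0. }
rewrite H0.
apply (is_lim_seq_continuous arcsinh).
- apply derivable_continuous_pt; eexists; apply derivable_pt_lim_arcsinh.
- apply is_lim_seq_mult'; [| apply is_lim_seq_const].
  apply (is_lim_seq_continuous sqrt); [| exact Hs].
  apply continuity_pt_sqrt; lra.
Qed.

(** * Comparing a point with one of the same modulus as the centre *)

(** Write [z = |z| (a + i b)]. Multiplied by [Re z Re p / (|z| |p|)], the
    hypothesis becomes
    [q + 1/q - 2 (a x' + b y') <= (x'/x) (2 - 2 a x - 2 b y)] with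
    [q = |p|/|z|]. The terms in [a] cancel, and [|b| <= 1] gives the
    bound. *)
Lemma Cmod_ratio_of_sep_le (z w p : C) :
  right_half_plane z -> right_half_plane w -> right_half_plane p ->
  Cmod w = Cmod z -> sep z p <= sep z w ->
  let x := Re w / Cmod w in let y := Im w / Cmod w in
  let x' := Re p / Cmod p in let y' := Im p / Cmod p in
  Cmod p / Cmod z + Cmod z / Cmod p - 2
    <= 2 * Rabs (x' / x - 1) + 2 * Rabs (y' - y * (x' / x)).
Proof.
intros Hz Hw Hp Hm Hs x y x' y'.
pose proof (Cmod_pos_half_plane z Hz) as Hz0.
pose proof (Cmod_pos_half_plane w Hw) as Hw0.
pose proof (Cmod_pos_half_plane p Hp) as Hp0.
unfold right_half_plane in *.
pose proof (Cmod_sqr z) as Hz2.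
pose proof (Cmod_sqr w) as Hw2; rewrite Hm in Hw2.
pose proof (Cmod_sqr p) as Hp2.
set (s := Im z / Cmod z).
assert (Hsb : Rabs s <= 1).
{ unfold s; rewrite Rabs_div, (Rabs_pos_eq (Cmod z)) by lra.
  apply Rle_div_l; [lra|]; rewrite Rmult_1_l.
  apply Rle_trans with (2 := Rmax_Cmod z), Rmax_r. }
assert (Hkey : Cmod p / Cmod z + Cmod z / Cmod p - 2
   <= 2 * (x' / x - 1) + 2 * (s * (y' - y * (x' / x)))).
{ unfold sep in Hs.
  apply (Rmult_le_compat_r (Re z * Re p)) in Hs; [|nra].
  replace (((Re z - Re p) ^ 2 + (Im z - Im p) ^ 2) / (Re z * Re p) *
           (Re z * Re p))
    with (Cmod z ^ 2 + Cmod p ^ 2 - 2 * (Re z * Re p + Im z * Im p)) in Hs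
    by (rewrite Hz2, Hp2; field; lra).
  replace (((Re z - Re w) ^ 2 + (Im z - Im w) ^ 2) / (Re z * Re w) *
           (Re z * Re p))
    with ((2 * Cmod z ^ 2 - 2 * (Re z * Re w + Im z * Im w)) * (Re p / Re w))
    in Hs
    by (replace (2 * Cmod z ^ 2) with (Cmod z ^ 2 + Cmod z ^ 2) by ring;
        rewrite Hz2 at 1; rewrite Hw2; field; lra).
  apply (Rmult_le_compat_r (/ (Cmod z * Cmod p))) in Hs;
    [| apply Rlt_le, Rinv_0_lt_compat; nra].
  unfold x, y, x', y', s; rewrite Hm.
  match type of Hs with ?a <= ?b =>
    match goal with |- ?c <= ?d =>
      assert (Hc : c - a = d - b) by (field; lra); lra end end. }
pose proof (Rle_abs (x' / x - 1)) as H1.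
pose proof (Rle_abs (s * (y' - y * (x' / x)))) as H2.
rewrite Rabs_mult in H2.
pose proof (Rabs_pos (y' - y * (x' / x))) as H3.
nra.
Qed.

(** * Curves in the half-plane that land at infinity *)

(** Freezing the curve on the negative axis turns the one-sided continuity at
    [0] into continuity on the whole line, which the extreme and intermediate
    value theorems for real functions ask for. *)
Lemma curve_Cmod_extension (gamma : R -> C) :
  curve gamma -> continuity (fun t => Cmod (gamma (Rmax 0 t))).
Proof.
intros [Hc _] t; apply continuity_pt_filterlim.
apply filterlim_comp with (G := locally (gamma (Rmax 0 t))) (f := fun t => gamma (Rmax 0 t)).
- apply filterlim_comp
    with (G := within (fun t => 0 <= t) (locally (Rmax 0 t))) (f := Rmax 0).
  + intros P HP.
    assert (Hm : filterlim (Rmax 0) (locally t) (locally (Rmax 0 t))).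
    (* max (0, u) = (0 + u + |u - 0|) / 2 is visibly continuous. *)
    { apply filterlim_ext with (fun t => (0 + t + Rabs (t - 0)) * / 2).
      - intros u; unfold Rmax; destruct (Rle_dec 0 u);
          [rewrite Rabs_pos_eq | rewrite Rabs_left]; lra.
      - replace (Rmax 0 t) with ((0 + t + Rabs (t - 0)) * / 2).
        + apply (proj1 (continuity_pt_filterlim
                  (fun u => (0 + u + Rabs (u - 0)) * / 2) t)); reg.
        + unfold Rmax; destruct (Rle_dec 0 t);
          [rewrite Rabs_pos_eq | rewrite Rabs_left]; lra. }
    specialize (Hm _ HP); unfold filtermap in *.
    apply filter_imp with (2 := Hm); intros u Hu; apply Hu, Rmax_l.
  + apply Hc, Rmax_l.
- exact (filterlim_norm (K := C_AbsRing) (V := C_NormedModule) (gamma (Rmax 0 t))).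
Qed.

Lemma curve_Cmod_bounded (gamma : R -> C) (T : R) :
  curve gamma -> exists M, forall t, 0 <= t <= T -> Cmod (gamma t) <= M.
Proof.
intros Hg.
pose proof (curve_Cmod_extension gamma Hg) as Hc.
destruct (Rle_lt_dec 0 T) as [HT | HT].
- destruct (continuity_ab_maj _ 0 T HT (fun c _ => Hc c)) as [Mx [HM _]].
  eexists; intros t Ht; specialize (HM t Ht); cbv beta in HM.
  rewrite (Rmax_right 0 t) in HM by lra; exact HM.
- exists 0; intros t Ht; lra.
Qed.

Lemma curve_meets_circle (gamma : R -> C) (r : R) :
  curve gamma -> lands_at_infty gamma -> Cmod (gamma 0) <= r ->
  exists t, 0 <= t /\ Cmod (gamma t) = r.
Proof.
intros Hg Hl Hr.
apply is_lim_spec in Hl; destruct (Hl r) as [T HT].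
set (T' := Rmax 0 (T + 1)).
assert (HT' : 0 <= T') by apply Rmax_l.
assert (HrT : r < Cmod (gamma T')).
{ apply HT; unfold T'; pose proof (Rmax_r 0 (T + 1)); lra. }
destruct (IVT_gen _ 0 T' r (curve_Cmod_extension gamma Hg)) as [t [Ht He]].
- cbv beta; rewrite (Rmax_right 0 T'), (Rmax_left 0 0) by lra.
  rewrite Rmin_left, Rmax_right; lra.
- rewrite Rmin_left, Rmax_right in Ht by lra.
  exists t; split; [lra|]; now rewrite Rmax_right in He by lra.
Qed.

Definition on_curve (gamma : R -> C) (w : C) : Prop :=
  exists t, 0 <= t /\ w = gamma t.

(** A curve is bounded on every bounded range of parameters, so its points of
    large modulus have large parameters. *)
Lemma parameter_escapes (gamma : R -> C) (t : nat -> R) :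
  curve gamma -> (forall n, 0 <= t n) ->
  is_lim_seq (fun n => Cmod (gamma (t n))) p_infty -> is_lim_seq t p_infty.
Proof.
intros Hg Ht Hm; apply is_lim_seq_spec; intros T.
destruct (curve_Cmod_bounded gamma T Hg) as [M HM].
apply is_lim_seq_spec in Hm; specialize (Hm M).
apply filter_imp with (2 := Hm); intros n Hn.
destruct (Rle_lt_dec (t n) T) as [H | H]; [exfalso | exact H].
specialize (HM (t n) (conj (Ht n) H)); lra.
Qed.

(** The direction is controlled in terms of the modulus rather than of the
    parameter: for the projections only the former can be estimated. *)
Lemma direction_limit (gamma : R -> C) (theta : R) (w : nat -> C) :
  curve gamma -> is_lim (fun t => Arg (gamma t)) p_infty theta ->
  (forall n, on_curve gamma (w n)) ->
  is_lim_seq (fun n => Cmod (w n)) p_infty ->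
  is_lim_seq (fun n => Re (w n) / Cmod (w n)) (cos theta) /\
  is_lim_seq (fun n => Im (w n) / Cmod (w n)) (sin theta).
Proof.
intros Hg Ha Hw Hm.
destruct (functional_choice _ Hw) as [t Ht].
assert (Hmt : is_lim_seq (fun n => Cmod (gamma (t n))) p_infty).
{ apply is_lim_seq_ext with (2 := Hm); intros n; now rewrite (proj2 (Ht n)). }
assert (Harg : is_lim_seq (fun n => Arg (w n)) theta).
{ apply is_lim_seq_ext with (fun n => Arg (gamma (t n))).
  - intros n; now rewrite (proj2 (Ht n)).
  - apply is_lim_comp_seq with (1 := Ha).
    + exists 0%nat; discriminate.
    + apply parameter_escapes with gamma; [exact Hg | apply Ht | exact Hmt]. }
assert (Hpos : forall n, 0 < Cmod (w n)).
{ intros n; apply Cmod_pos_half_plane; destruct (Ht n) as [H ->].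
  now apply Hg. }
assert (Hpol : forall n, Re (w n) / Cmod (w n) = cos (Arg (w n)) /\
                         Im (w n) / Cmod (w n) = sin (Arg (w n))).
{ intros n; specialize (Hpos n).
  assert (Hne : w n <> 0%C) by now apply Cmod_gt_0.
  assert (H1 : Re (w n) = Cmod (w n) * cos (Arg (w n)))
    by exact (f_equal Re (Arg_polar _ Hne)).
  assert (H2 : Im (w n) = Cmod (w n) * sin (Arg (w n)))
    by exact (f_equal Im (Arg_polar _ Hne)).
  split; [rewrite H1 at 1 | rewrite H2 at 1]; field; lra. }
split.
- apply is_lim_seq_ext with (fun n => cos (Arg (w n))).
  + intros n; symmetry; apply Hpol.
  + apply (is_lim_seq_continuous cos); [apply continuity_cos | exact Harg].
- apply is_lim_seq_ext with (fun n => sin (Arg (w n))).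
  + intros n; symmetry; apply Hpol.
  + apply (is_lim_seq_continuous sin); [apply continuity_sin | exact Harg].
Qed.

(** The moduli agree only eventually, since the circle of radius [|z n|] can
    miss the curve as long as [z n] is closer to the origin than
    the starting point. *)
Lemma comparison_sequence (gamma : R -> C) (z : nat -> C) :
  curve gamma -> lands_at_infty gamma -> converges_to_infty z ->
  exists w : nat -> C, (forall n, on_curve gamma (w n)) /\
    eventually (fun n => Cmod (w n) = Cmod (z n)).
Proof.
intros Hg Hl Hz.
assert (H : forall n, exists w, on_curve gamma w /\
  (Cmod (gamma 0) <= Cmod (z n) -> Cmod w = Cmod (z n))).
{ intros n; destruct (Rle_lt_dec (Cmod (gamma 0)) (Cmod (z n))) as [Hn | Hn].
  - destruct (curve_meets_circle gamma _ Hg Hl Hn) as [t [Ht He]].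
    exists (gamma t); split; [now exists t | now intros _].
  - exists (gamma 0); split; [exists 0; split; [apply Rle_refl | reflexivity] | lra]. }
apply functional_choice in H; destruct H as [w Hw].
exists w; split; [intros n; apply Hw|].
apply is_lim_seq_spec in Hz; specialize (Hz (Cmod (gamma 0))).
apply filter_imp with (2 := Hz); intros n Hn; apply Hw; lra.
Qed.

(** * Asymptotics of the projections *)

(** Let [d = q + 1/q - 2]. Then [(q - 1)^2 = q d], and [q <= 2 + d]
    because [1/q > 0], so [(q - 1)^2] is at most [(2 + d) d]. *)
Lemma is_lim_seq_1_of_add_inv (q e : nat -> R) :
  (forall n, 0 < q n) ->
  eventually (fun n => q n + / q n - 2 <= e n) ->
  is_lim_seq e 0 -> is_lim_seq q 1.
Proof.
intros Hq Hle He.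
assert (Hsq : is_lim_seq (fun n => (q n - 1) ^ 2) 0).
{ apply is_lim_seq_le_le_loc with (fun _ => 0) (fun n => (2 + e n) * e n).
  - apply filter_imp with (2 := Hle); intros n Hn; specialize (Hq n).
    split; [apply pow2_ge_0|].
    assert (Hi : 0 < / q n) by now apply Rinv_0_lt_compat.
    assert (H2 : (q n - 1) ^ 2 = q n * (q n + / q n - 2)) by (field; lra).
    assert (H0 : 0 <= q n + / q n - 2).
    { apply Rmult_le_reg_l with (q n); [exact Hq|].
      rewrite Rmult_0_r, <- H2; apply pow2_ge_0. }
    rewrite H2; apply Rmult_le_compat; lra.
  - apply is_lim_seq_const.
  - replace (Finite 0) with (Finite ((2 + 0) * 0)) by (f_equal; ring).
    apply is_lim_seq_mult'; [| exact He].
    apply is_lim_seq_plus'; [apply is_lim_seq_const | exact He]. }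
assert (Habs : is_lim_seq (fun n => Rabs (q n - 1)) 0).
{ apply is_lim_seq_ext with (fun n => sqrt ((q n - 1) ^ 2)).
  - intros n; rewrite <- sqrt_Rsqr_abs; f_equal; unfold Rsqr; ring.
  - rewrite <- sqrt_0; apply (is_lim_seq_continuous sqrt); [| exact Hsq].
    apply continuity_pt_sqrt; lra. }
apply (proj2 (is_lim_seq_abs_0 _)) in Habs.
apply is_lim_seq_ext with (fun n => (q n - 1) + 1); [intros n; ring|].
replace (Finite 1) with (Finite (0 + 1)) by (f_equal; ring).
apply is_lim_seq_plus'; [exact Habs | apply is_lim_seq_const].
Qed.

Lemma curve_projection (gamma : R -> C) (z p w : C) :
  curve gamma -> right_half_plane z -> is_projection gamma z p ->
  on_curve gamma w -> on_curve gamma p /\ sep z p <= sep z w.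
Proof.
intros [_ Hg] Hz [t0 [Ht0 [-> [Hlb _]]]] [t [Ht ->]].
split; [now exists t0|].
apply sep_le_of_dH_le; [exact Hz | now apply Hg | now apply Hg |].
apply (Hlb (dH z (gamma t))); now exists t.
Qed.

(** Rescaling by [Cmod (z n)] gives a limit, [e^(i theta)], that remembers neither
    the curve nor the arguments of the [z n]; so the projections onto two curves
    with the same [theta] become indistinguishable at this scale. *)
Lemma projection_asymptotics (gamma : R -> C) (theta : R) (z p : nat -> C) :
  curve gamma -> lands_at_infty gamma ->
  - (PI / 2) < theta < PI / 2 ->
  is_lim (fun t : R => Arg (gamma t)) p_infty theta ->
  (forall n, right_half_plane (z n)) -> converges_to_infty z ->
  (forall n, is_projection gamma (z n) (p n)) ->
  is_lim_seq (fun n => Re (p n) / Cmod (z n)) (cos theta) /\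
  is_lim_seq (fun n => Im (p n) / Cmod (z n)) (sin theta).
Proof.
intros Hg Hl Hth Ha Hz Hzi Hp.
assert (Hc : 0 < cos theta) by (apply cos_gt_0; lra).
destruct (comparison_sequence gamma z Hg Hl Hzi) as [w [Hw Hwz]].
assert (Hpw : forall n, on_curve gamma (p n) /\ sep (z n) (p n) <= sep (z n) (w n)).
{ intros n; now apply curve_projection. }
assert (Hcurve : forall v, on_curve gamma v -> right_half_plane v).
{ intros v [t [Ht ->]]; now apply Hg. }
assert (Hz0 : forall n, 0 < Cmod (z n)).
{ intros n; apply Cmod_pos_half_plane, Hz. }
assert (Hp0 : forall n, 0 < Cmod (p n)).
{ intros n; apply Cmod_pos_half_plane, Hcurve, Hpw. }
assert (Hwi : is_lim_seq (fun n => Cmod (w n)) p_infty).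
{ apply is_lim_seq_ext_loc with (2 := Hzi).
  apply filter_imp with (2 := Hwz); intros n Hn; now symmetry. }
destruct (direction_limit gamma theta w Hg Ha Hw Hwi) as [Hwx Hwy].
set (x := fun n => Re (w n) / Cmod (w n)) in *.
set (y := fun n => Im (w n) / Cmod (w n)) in *.
set (x' := fun n => Re (p n) / Cmod (p n)).
set (y' := fun n => Im (p n) / Cmod (p n)).
assert (Hratio : eventually (fun n =>
  Cmod (p n) / Cmod (z n) + Cmod (z n) / Cmod (p n) - 2
    <= 2 * Rabs (x' n / x n - 1) + 2 * Rabs (y' n - y n * (x' n / x n)))).
{ apply filter_imp with (2 := Hwz); intros n Hn.
  apply Cmod_ratio_of_sep_le;
    [apply Hz | apply Hcurve, Hw | apply Hcurve, Hpw | exact Hn | apply Hpw]. }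
(* With |x'|, |y'|, |y| <= 1 the right-hand side of the ratio inequality is at
   most 2 (1/x + 1) + 2 (1 + 1/x) = 4 + 4/x, hence |z|/|p| <= 6 + 4/x. *)
assert (Hpi : is_lim_seq (fun n => Cmod (p n)) p_infty).
{ apply is_lim_seq_le_p_loc with (fun n => Cmod (z n) * / (6 + 4 * / x n)).
  - apply filter_imp with (2 := Hratio); intros n Hn.
    specialize (Hz0 n); specialize (Hp0 n).
    assert (Hw0 : 0 < Cmod (w n)) by (apply Cmod_pos_half_plane, Hcurve, Hw).
    assert (Hunit : forall v, 0 < Cmod v ->
              Rabs (Re v / Cmod v) <= 1 /\ Rabs (Im v / Cmod v) <= 1).
    { intros v Hv; pose proof (Rmax_Cmod v) as Hmax.
      pose proof (Rmax_l (Rabs (fst v)) (Rabs (snd v))).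
      pose proof (Rmax_r (Rabs (fst v)) (Rabs (snd v))).
      unfold Re, Im.
      split; rewrite Rabs_div, (Rabs_pos_eq (Cmod v)) by lra;
        (apply Rle_div_l; lra). }
    destruct (Hunit (p n) Hp0) as [Hx'1 Hy'1].
    destruct (Hunit (w n) Hw0) as [_ Hy1].
    fold (x' n) in Hx'1; fold (y' n) in Hy'1; fold (y n) in Hy1.
    assert (Hxn : 0 < x n).
    { apply Rdiv_lt_0_compat; [apply Hcurve, Hw | exact Hw0]. }
    assert (Hix : 0 < / x n) by now apply Rinv_0_lt_compat.
    assert (Hquo : Rabs (x' n / x n) <= / x n).
    { unfold Rdiv; rewrite Rabs_mult, (Rabs_pos_eq (/ x n)) by lra; nra. }
    assert (HA : Rabs (x' n / x n - 1) <= / x n + 1).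
    { eapply Rle_trans; [apply Rabs_triang|].
      rewrite Rabs_Ropp, Rabs_R1; lra. }
    assert (HB : Rabs (y' n - y n * (x' n / x n)) <= 1 + / x n).
    { eapply Rle_trans; [apply Rabs_triang|].
      rewrite Rabs_Ropp, Rabs_mult.
      pose proof (Rabs_pos (y n)); pose proof (Rabs_pos (x' n / x n)); nra. }
    assert (Hpos : 0 < Cmod (p n) / Cmod (z n)) by now apply Rdiv_lt_0_compat.
    assert (Hzp : Cmod (z n) / Cmod (p n) <= 6 + 4 * / x n) by lra.
    apply Rle_div_l in Hzp; [|exact Hp0].
    apply Rle_div_l; [lra|]; rewrite Rmult_comm; exact Hzp.
  - eapply is_lim_seq_mult; [exact Hzi | |].
    + apply (is_lim_seq_inv _ (Finite (6 + 4 * / cos theta))).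
      * apply is_lim_seq_plus'; [apply is_lim_seq_const|].
        apply is_lim_seq_mult'; [apply is_lim_seq_const|].
        apply (is_lim_seq_inv _ (Finite (cos theta))); [exact Hwx|].
        intros He; injection He; lra.
      * pose proof (Rinv_0_lt_compat _ Hc); intros He; injection He; lra.
    + apply is_Rbar_mult_p_infty_pos; simpl.
      pose proof (Rinv_0_lt_compat _ Hc); apply Rinv_0_lt_compat; lra. }
destruct (direction_limit gamma theta p Hg Ha (fun n => proj1 (Hpw n)) Hpi)
  as [Hpx Hpy].
fold x' in Hpx; fold y' in Hpy.
assert (Hquo : is_lim_seq (fun n => x' n / x n) 1).
{ replace (Finite 1) with (Finite (cos theta / cos theta)) by (f_equal; field; lra).
  apply is_lim_seq_div'; [exact Hpx | exact Hwx | lra]. }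
assert (Hq : is_lim_seq (fun n => Cmod (p n) / Cmod (z n)) 1).
{ apply is_lim_seq_1_of_add_inv with
    (fun n => 2 * Rabs (x' n / x n - 1) + 2 * Rabs (y' n - y n * (x' n / x n))).
  - intros n; now apply Rdiv_lt_0_compat.
  - apply filter_imp with (2 := Hratio); intros n Hn.
    now rewrite Rinv_div.
  - replace (Finite 0) with (Finite (2 * 0 + 2 * 0)) by (f_equal; ring).
    apply is_lim_seq_plus'; (apply is_lim_seq_mult'; [apply is_lim_seq_const|]);
      apply (proj1 (is_lim_seq_abs_0 _)).
    + replace (Finite 0) with (Finite (1 - 1)) by (f_equal; ring).
      apply is_lim_seq_minus'; [exact Hquo | apply is_lim_seq_const].
    + replace (Finite 0) with (Finite (sin theta - sin theta * 1)) by (f_equal; ring).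
      apply is_lim_seq_minus'; [exact Hpy|].
      apply is_lim_seq_mult'; [exact Hwy | exact Hquo]. }
split.
- apply is_lim_seq_ext with (fun n => x' n * (Cmod (p n) / Cmod (z n))).
  + intros n; specialize (Hz0 n); specialize (Hp0 n); unfold x'; field; lra.
  + rewrite <- (Rmult_1_r (cos theta)); now apply is_lim_seq_mult'.
- apply is_lim_seq_ext with (fun n => y' n * (Cmod (p n) / Cmod (z n))).
  + intros n; specialize (Hz0 n); specialize (Hp0 n); unfold y'; field; lra.
  + rewrite <- (Rmult_1_r (sin theta)); now apply is_lim_seq_mult'.
Qed.

(** Both sequences may be divided by [r n] before passing to the limit, because
    [sep] is invariant under dilations. *)
Lemma is_lim_seq_sep_0 (p1 p2 : nat -> C) (r : nat -> R) (a b : R) :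
  (forall n, 0 < r n) ->
  (forall n, right_half_plane (p1 n)) -> (forall n, right_half_plane (p2 n)) ->
  0 < a ->
  is_lim_seq (fun n => Re (p1 n) / r n) a -> is_lim_seq (fun n => Im (p1 n) / r n) b ->
  is_lim_seq (fun n => Re (p2 n) / r n) a -> is_lim_seq (fun n => Im (p2 n) / r n) b ->
  is_lim_seq (fun n => sep (p1 n) (p2 n)) 0.
Proof.
intros Hr H1 H2 Ha Hx1 Hy1 Hx2 Hy2.
apply is_lim_seq_ext with (fun n =>
  ((Re (p1 n) / r n - Re (p2 n) / r n) * (Re (p1 n) / r n - Re (p2 n) / r n) +
   (Im (p1 n) / r n - Im (p2 n) / r n) * (Im (p1 n) / r n - Im (p2 n) / r n)) /
  (Re (p1 n) / r n * (Re (p2 n) / r n))).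
{ intros n; specialize (Hr n); specialize (H1 n); specialize (H2 n).
  unfold right_half_plane in *; unfold sep; field; lra. }
replace (Finite 0) with
  (Finite (((a - a) * (a - a) + (b - b) * (b - b)) / (a * a)))
  by (f_equal; field; lra).
apply is_lim_seq_div'; [| now apply is_lim_seq_mult' | nra].
apply is_lim_seq_plus'; apply is_lim_seq_mult'; now apply is_lim_seq_minus'.
Qed.

Theorem theorem4p4 :
  forall (gamma1 gamma2 : R -> C) (theta : R) (z p1 p2 : nat -> C),
    curve gamma1 -> curve gamma2 ->
    lands_at_infty gamma1 -> lands_at_infty gamma2 ->
    - (PI / 2) < theta < PI / 2 ->
    is_lim (fun t : R => Arg (gamma1 t)) p_infty theta ->
    is_lim (fun t : R => Arg (gamma2 t)) p_infty theta ->
    (forall n : nat, right_half_plane (z n)) ->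
    converges_to_infty z ->
    (forall n : nat, is_projection gamma1 (z n) (p1 n)) ->
    (forall n : nat, is_projection gamma2 (z n) (p2 n)) ->
    is_lim_seq (fun n : nat => dH (p1 n) (p2 n)) 0.
Proof.
intros gamma1 gamma2 theta z p1 p2 Hg1 Hg2 Hl1 Hl2 Hth Ha1 Ha2 Hz Hzi Hp1 Hp2.
assert (Hc : 0 < cos theta) by (apply cos_gt_0; lra).
assert (H1 : forall n, right_half_plane (p1 n)).
{ intros n; destruct (Hp1 n) as [t [Ht [-> _]]]; now apply Hg1. }
assert (H2 : forall n, right_half_plane (p2 n)).
{ intros n; destruct (Hp2 n) as [t [Ht [-> _]]]; now apply Hg2. }
destruct (projection_asymptotics gamma1 theta z p1) as [Hx1 Hy1]; try assumption.
destruct (projection_asymptotics gamma2 theta z p2) as [Hx2 Hy2]; try assumption.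
apply is_lim_seq_dH_0; [assumption | assumption |].
apply is_lim_seq_sep_0 with (fun n => Cmod (z n)) (cos theta) (sin theta);
  try assumption.
intros n; apply Cmod_pos_half_plane, Hz.
Qed.
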